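(* Let $H$ be an infinite-dimensional Hilbert space and let $\mathrm{id}$ denote the identity operator on $H$. Then the operator $2\,\mathrm{id}$ belongs to the closure of $\{T\in\mathcal{B}(H) : T \text{ is a } 2\text{-isometry}\}$ in the strong operator topology: $$2\,\mathrm{id}\in\overline{\{T\in\mathcal{B}(H) : T \text{ is a } 2\text{-isometry}\}}^{SOT}.$$
   Context: $\mathcal{B}(H)$ denotes the bounded linear operators on $H$. An operator $T\in\mathcal{B}(H)$ is called a $2$-isometry if $1-2T^*T+{T^*}^2T^2=0$, where $1$ is the identity operator. SOT denotes the strong operator topology on $\mathcal{B}(H)$ (the topology of pointwise norm convergence of nets: $T_\alpha\to T$ iff $\|T_\alpha x-Tx\|\to 0$ for every $x\in H$), and $\overline{\,\cdot\,}^{SOT}$ is the topological closure with respect to it (i.e. under nets, not only sequences). *)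

(* Defs.v *)
From HB Require Import structures.
From mathcomp Require Import all_boot all_order all_algebra.
From mathcomp Require Import complex.
From mathcomp Require Import boolp classical_sets reals topology normedtype.

Set Implicit Arguments.
Unset Strict Implicit.
Unset Printing Implicit Defensive.

Import Order.TTheory GRing.Theory Num.Theory.
Import numFieldNormedType.Exports.

Local Open Scope classical_set_scope.
Local Open Scope ring_scope.

(* K is the field of real numbers with the trivial conjugation, or the field of
   complex numbers with the usual one. *)
Variant real_or_complex (R : realType) :
    forall K : numFieldType, (K -> K) -> Prop :=
| RealScalars : @real_or_complex R R idfun
| ComplexScalars : @real_or_complex R R[i] (@conjc R).

Definition infinite_dimensional (K : numFieldType) (V : lmodType K) : Prop :=
  ~ exists (n : nat) (e : 'I_n -> V),
      forall x : V, exists c : 'I_n -> K, x = \sum_(i < n) c i *: e i.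

Record bounded_operator (K : numFieldType) (H : normedModType K) :=
  BoundedOperator {
    operator_fun :> {linear H -> H} ;
    operator_bounded :
      exists M : K, forall x : H, `|operator_fun x| <= M * `|x| }.

(* initial_topology requires a choiceType *)
HB.instance Definition _ (K : numFieldType) (H : normedModType K) :=
  gen_eqMixin (bounded_operator H).
HB.instance Definition _ (K : numFieldType) (H : normedModType K) :=
  gen_choiceMixin (bounded_operator H).

Definition operator_ptws (K : numFieldType) (H : normedModType K)
  (T : bounded_operator H) : {ptws H -> H} := T : H -> H.

(* B(H) with the strong operator topology; kept as an alias because the default
   topology on B(H) would be that of the operator norm. *)
Definition sot (K : numFieldType) (H : normedModType K) : Type :=
  initial_topology (@operator_ptws K H).

HB.instance Definition _ (K : numFieldType) (H : normedModType K) :=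
  Topological.copy (sot H) (initial_topology (@operator_ptws K H)).

Lemma sot_cvgP (K : numFieldType) (H : normedModType K)
    (F : set_system (sot H)) (T : sot H) : Filter F ->
  F --> T <-> forall x : H,
    (fun S : sot H => (S : bounded_operator H) x) @ F -->
      (T : bounded_operator H) x.
Proof.
have cvg_initial (S : choiceType) (Y : topologicalType) (f : S -> Y)
    (G : set_system S) (s : S) : Filter G ->
    G --> (s : initial_topology f) <-> f @ G --> f s.
  move=> FG; split=> [Gs A fsA|Gs A].
    exact/Gs/(@initial_continuous _ _ f).
  rewrite nbhsE => -[B [[C oC CB] Bs] BA].
  apply: (filterS BA); rewrite -CB.
  by apply: Gs; apply: open_nbhs_nbhs; split=> //; move: Bs; rewrite -CB.
move=> FF.
have -> : (F --> T) <->
    ((@operator_ptws K H) @ F --> operator_ptws T) by exact: cvg_initial.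
split=> [/cvg_sup FT x|FT].
  by have /cvg_initial := FT x; apply; exact: fmap_filter.
by apply/cvg_sup => x; apply/cvg_initial; exact: FT.
Qed.

Lemma scale_bounded (K : numFieldType) (H : normedModType K) (a : K) :
  exists M : K, forall x : H, `|(a \*: idfun : {linear H -> H}) x| <= M * `|x|.
Proof. by exists `|a| => x; rewrite /= normrZ. Qed.

Definition scale_operator (K : numFieldType) (H : normedModType K) (a : K) :
  bounded_operator H := BoundedOperator (@scale_bounded K H a).

Section TwoIsometry.
Context (K : numFieldType) (theta : K -> K) (H : normedModType K).
Context (ip : {dot H for theta}).

Definition is_adjoint (T S : bounded_operator H) : Prop :=
  forall x y : H, ip (T x) y = ip x (S y).

Lemma is_adjoint_unique (T S S' : bounded_operator H) :
  is_adjoint T S -> is_adjoint T S' -> forall y, S y = S' y.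
Proof.
move=> TS TS' y; apply/eqP; rewrite -subr_eq0; apply/negP => /negP.
move=> /(@neq0_dnorm_gt0 _ _ _ ip).
set d := S y - S' y; have -> : ip d d = ip d (S y) - ip d (S' y).
  exact: linearBr.
by rewrite -TS -TS' subrr ltxx.
Qed.

(* 1 - 2 T^* T + T^*^2 T^2 = 0, where S is the adjoint T^*: it is unique by
   is_adjoint_unique, and exists for all T when H is complete (Riesz). *)
Definition two_isometry (T : bounded_operator H) : Prop :=
  exists2 S : bounded_operator H, is_adjoint T S &
    forall x : H, x - 2 *: S (T x) + S (S (T (T x))) = 0.

End TwoIsometry.

(* Main.v *)
From HB Require Import structures.
Require Import Defs.
From mathcomp Require Import all_boot all_order all_algebra.
From mathcomp Require Import complex.
From mathcomp Require Import boolp classical_sets reals topology normedtype.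
From mathcomp Require Import sequences ring.

(** A bounded operator T is a 2-isometry exactly when D = T' T - 1, with T' the
adjoint of T, satisfies T' D T = D. If S is an isometry and P an orthogonal
projection onto a subspace on which S' is multiplication by some 0 < a < 1,
then T = S (1 + (1/a - 1) P) has this property: T' T = 1 + (1/a^2 - 1) P and
T' P = P = P T (rank_perturbed_isometry).

Such a T has norm 1/a, and for small a it almost doubles certain vectors. Let u
be a unit vector with S' u = a u, let y solve 2 y = S y + S u, and put
x = y + <y,u> u. Then <y,u> = a / (2 - a), and the terms of T x that involve
S u add up to exactly S u, so that T x = S y + S u = 2 y, which is
2 x - 2 <y,u> u. As a tends to 0 the error tends to 0 while the norm of x stays
above 1/2. Starting from m orthonormal vectors u_i the resulting x_i are
orthogonal and of equal norm (near_eigenvectors). No surjective S can occur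
here: S' is then an isometry without the eigenvalue a. So S is taken to be a
shift of multiplicity m along an orthonormal sequence, which exists because H
is infinite-dimensional (Gram_Schmidt, shift_isometry); the resolvent of S
turns the m vectors killed by S' into eigenvectors of S' for the eigenvalue a.

A neighbourhood of 2 id in the strong topology only constrains finitely many
vectors, hence an orthonormal list b_0, ..., b_(m-1) spanning them. The shift is
chosen to fix the b_i; this makes the normalized vectors e_i = x_i / |x_i|
orthogonal to the b_j, and conjugating T by the self-adjoint unitary that
swaps each b_i with e_i gives a 2-isometry that almost doubles the b_i
(two_isometry_near_double_on).

Operators are handled as functions T together with a formal adjoint T'. The
existence of T' makes T linear, so that linearity never has to be checked along
the way. *)

Set Implicit Arguments.
Unset Strict Implicit.
Unset Printing Implicit Defensive.

Import Order.TTheory GRing.Theory Num.Theory.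
Import numFieldNormedType.Exports.

Local Open Scope classical_set_scope.
Local Open Scope ring_scope.

(** * Order and conjugation on the scalars *)

(** In the complex case the terms s n and the bound M differ by reals only,
because a comparison of complex numbers forces equal imaginary parts; the
statement then concerns the real parts. *)
Lemma bounded_nondecreasing_cauchy (R : realType) (K : numFieldType)
    (theta : K -> K) (scalars : real_or_complex R theta) (s : nat -> K) (M : K) :
  (forall n, s n <= s n.+1) -> (forall n, s n <= M) ->
  forall e, 0 < e -> exists N, forall n, (N <= n)%N -> s n - s N < e.
Proof.
have real_case (t : nat -> R) (B : R) :
    (forall n, t n <= t n.+1) -> (forall n, t n <= B) ->
    forall e, 0 < e -> exists N, forall n, (N <= n)%N -> t n - t N < e.
  move=> tS tB e e0.
  have tmono : {homo t : m n / (m <= n)%N >-> m <= n}.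
    by apply: homo_leq => //; exact: le_trans.
  have tcvg : cvgn t.
    by apply: nondecreasing_is_cvgn => //; exists B => _ [n _ <-].
  have /cvgrPdist_lt/(_ e e0)[N _ tN] := tcvg.
  exists N => n _.
  have := tN N (leqnn N) => /=.
  apply: le_lt_trans; apply: le_trans (ler_norm _); rewrite lerD2r.
  exact: nondecreasing_cvgn_le.
case: scalars s M => [s M|s M sS sM e e0]; first exact: real_case.
have ReS n : complex.Re (s n) <= complex.Re (s n.+1).
  by have := sS n; rewrite lecE => /andP[].
have ReM n : complex.Re (s n) <= complex.Re M.
  by have := sM n; rewrite lecE => /andP[].
move: (e0); rewrite ltcE => /andP[/eqP Ime Ree0].
have [N sN] := real_case _ _ ReS ReM _ Ree0; exists N => n /sN.
have Im_s k : complex.Im (s k) = complex.Im M.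
  by have := sM k; rewrite lecE => /andP[/eqP].
rewrite ltcE Ime; move: (Im_s n) (Im_s N).
by case: (s n) => a b; case: (s N) => a' b' /= -> ->; rewrite subrr eqxx.
Qed.

Lemma conj_ge0 (R : realType) (K : numFieldType) (theta : K -> K)
  (scalars : real_or_complex R theta) (a : K) : 0 <= a -> theta a = a.
Proof.
case: scalars a => [//|[a b]]; rewrite lecE /= => /andP[/eqP -> _].
by rewrite oppr0.
Qed.

(** * Inner product *)

Section InnerProduct.
Context (R : realType) (K : numFieldType) (theta : K -> K).
Context (scalars : real_or_complex R theta).
Context (H : completeNormedModType K) (ip : {dot H for theta}).
Context (normE : forall x : H, ip x x = `|x| ^+ 2).

Let ipDl x y z : ip (x + y) z = ip x z + ip y z. Proof. exact: linearDl. Qed.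
Let ipDr x y z : ip z (x + y) = ip z x + ip z y. Proof. exact: linearDr. Qed.
Let ipBl x y z : ip (x - y) z = ip x z - ip y z. Proof. exact: linearBl. Qed.
Let ipBr x y z : ip z (x - y) = ip z x - ip z y. Proof. exact: linearBr. Qed.
Let ipNl x z : ip (- x) z = - ip x z. Proof. exact: linearNl. Qed.
Let ipNr x z : ip z (- x) = - ip z x. Proof. exact: linearNr. Qed.
Let ip0l z : ip 0 z = 0. Proof. exact: linear0l. Qed.
Let ip0r z : ip z 0 = 0. Proof. exact: linear0r. Qed.
Let ipZl a x z : ip (a *: x) z = a * ip x z. Proof. exact: linearZl_LR. Qed.
Let ipZr a x z : ip z (a *: x) = theta a * ip z x. Proof. exact: linearZr_LR. Qed.

Lemma ipC x y : ip x y = theta (ip y x).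
Proof. by rewrite (hermitian_subproof (s := ip)) expr0 mul1r. Qed.

Lemma ipZr_ge0 a x z : 0 <= a -> ip z (a *: x) = a * ip z x.
Proof. by move=> a0; rewrite ipZr (conj_ge0 scalars a0). Qed.

Lemma ip_eq0C x y : ip x y = 0 -> ip y x = 0.
Proof. by move=> xy0; rewrite ipC xy0 (conj_ge0 scalars). Qed.

Lemma ip_inj x x' : (forall y, ip x y = ip x' y) -> x = x'.
Proof.
move=> xx'; apply/eqP; rewrite -subr_eq0 -normr_eq0 -sqrf_eq0 -normE.
by rewrite ipBl xx' subrr.
Qed.

Lemma isometry_norm x y : ip x x = ip y y -> `|x| = `|y|.
Proof. by move=> xy; apply/eqP; rewrite -(@eqrXn2 _ 2) // -!normE xy. Qed.

Lemma CauchySchwarz x y : `|ip x y| <= `|x| * `|y|.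
Proof.
have [->|y0] := eqVneq y 0; first by rewrite ip0r !normr0 mulr0.
have n0 : 0 < `|y| ^+ 2 by rewrite exprn_gt0 ?normr_gt0.
(* |p|^2 = p * theta p for p = ip x y, read off from the norm of p *: y. *)
have pp : ip x y * ip y x = `|ip x y| ^+ 2.
  apply: (mulIf (lt0r_neq0 n0)); rewrite -exprMn -normrZ -[RHS]normE.
  by rewrite ipZl ipZr -ipC normE -mulrA.
have : 0 <= ip (`|y| ^+ 2 *: x - ip x y *: y) (`|y| ^+ 2 *: x - ip x y *: y).
  by rewrite normE exprn_ge0.
rewrite ipBl !ipBr !ipZl !(ipZr_ge0 _ _ (ltW n0)) !ipZr -ipC !normE.
set n := `|y| ^+ 2 in n0 *.
rewrite (_ : _ - _ = n * (n * `|x| ^+ 2 - `|ip x y| ^+ 2)).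
  rewrite pmulr_rge0 // subr_ge0 /n -exprMn ler_pXn2r ?nnegrE ?mulr_ge0 //.
  by rewrite mulrC.
rewrite -pp; ring.
Qed.

Lemma ip_cvgl (z : nat -> H) (l y : H) :
  z n @[n --> \oo] --> l -> ip (z n) y @[n --> \oo] --> ip l y.
Proof.
move=> zl; apply/cvgrPdist_lt => e e0.
have d0 : 0 < `|y| + 1 by rewrite ltr_wpDl.
have /cvgrPdist_lt/(_ (e / (`|y| + 1)) (divr_gt0 e0 d0)) := zl.
apply: filterS => n; rewrite ltr_pdivlMr // -ipBl => lt_e.
apply: le_lt_trans lt_e; apply: le_trans (CauchySchwarz _ _) _.
by rewrite ler_wpM2l // lerDl.
Qed.

Lemma ip_cvgr (z : nat -> H) (l y : H) :
  z n @[n --> \oo] --> l -> ip y (z n) @[n --> \oo] --> ip y l.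
Proof.
move=> zl; apply/cvgrPdist_lt => e e0.
have d0 : 0 < `|y| + 1 by rewrite ltr_wpDl.
have /cvgrPdist_lt/(_ (e / (`|y| + 1)) (divr_gt0 e0 d0)) := zl.
apply: filterS => n; rewrite ltr_pdivlMr // -ipBr => lt_e.
apply: le_lt_trans lt_e; apply: le_trans (CauchySchwarz _ _) _.
by rewrite mulrC ler_wpM2l // lerDl.
Qed.

Lemma cauchy_seq_cvg (z : nat -> H) :
  (forall e, 0 < e -> exists N, forall n, (N <= n)%N -> `|z N - z n| < e) ->
  cvgn z.
Proof.
move=> zC; apply/cauchy_cvgP/cauchy_exP => e /zC[N zN].
exists (z N); exists N => // n /zN; rewrite -ball_normE.
exact.
Qed.

(** * Finite sums along orthogonal families *)

(** The operator sending f i to g i for i < n when f is orthonormal. For f = g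
it is the orthogonal projection onto the span of the f i. *)
Definition frame_sum (f g : nat -> H) n x := \sum_(i < n) ip x (f i) *: g i.

Lemma ip_frame_suml f g n x y :
  ip (frame_sum f g n x) y = \sum_(i < n) ip x (f i) * ip (g i) y.
Proof. by rewrite linear_sumlz; apply: eq_bigr => i _; exact: ipZl. Qed.

Lemma ip_frame_sumr f g n x y :
  ip x (frame_sum g f n y) = \sum_(i < n) ip x (f i) * ip (g i) y.
Proof.
rewrite linear_sumr; apply: eq_bigr => i _.
by rewrite [LHS]ipZr -ipC mulrC.
Qed.

Lemma frame_sum_adj f g n x y :
  ip (frame_sum f g n x) y = ip x (frame_sum g f n y).
Proof. by rewrite ip_frame_suml ip_frame_sumr. Qed.

(** The common squared length l is a parameter: it is 1 for orthonormal families
and 2 for the differences of two mutually orthogonal orthonormal families. *)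
Definition orthofamily (l : K) n (w : nat -> H) :=
  forall i j, (i < n)%N -> (j < n)%N -> ip (w i) (w j) = (i == j)%:R * l.

Lemma frame_sum_coef l f g n x j : orthofamily l n g -> (j < n)%N ->
  ip (frame_sum f g n x) (g j) = l * ip x (f j).
Proof.
move=> og jn; rewrite ip_frame_suml (bigD1 (Ordinal jn)) //= og // eqxx mul1r.
rewrite big1 ?addr0 1?mulrC // => i ij; rewrite og //.
by rewrite (negbTE (ij : nat_of_ord i != j)) mul0r mulr0.
Qed.

Lemma frame_sumM l f g h n x : orthofamily l n g ->
  frame_sum g h n (frame_sum f g n x) = l *: frame_sum f h n x.
Proof.
move=> og; rewrite scaler_sumr; apply: eq_bigr => i _.
by rewrite (frame_sum_coef _ _ og) // scalerA.
Qed.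

Lemma frame_sum_basis l f g n j : orthofamily l n f -> (j < n)%N ->
  frame_sum f g n (f j) = l *: g j.
Proof.
move=> og jn; rewrite /frame_sum (bigD1 (Ordinal jn)) //= og // eqxx mul1r.
rewrite big1 ?addr0 // => i ij; rewrite og //.
by rewrite eq_sym (negbTE (ij : nat_of_ord i != j)) mul0r scale0r.
Qed.

Lemma frame_sum_orth f g n x : (forall i, (i < n)%N -> ip x (f i) = 0) ->
  frame_sum f g n x = 0.
Proof. by move=> xf; apply: big1 => i _; rewrite xf // scale0r. Qed.

Lemma Bessel f n x : orthofamily 1 n f ->
  \sum_(i < n) ip x (f i) * ip (f i) x <= `|x| ^+ 2.
Proof.
move=> of_; rewrite -ip_frame_suml; set Q := frame_sum f f n.
have : 0 <= ip (x - Q x) (x - Q x) by rewrite normE exprn_ge0.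
rewrite ipBl !ipBr -[ip x (Q x)]frame_sum_adj -/Q.
rewrite [ip (Q x) (Q x)]frame_sum_adj (frame_sumM _ _ _ of_) scale1r.
by rewrite -[ip x (frame_sum _ _ _ _)]frame_sum_adj subrr subr0 normE subr_ge0.
Qed.

Lemma frame_sumZ f g n a x : frame_sum f g n (a *: x) = a *: frame_sum f g n x.
Proof.
by rewrite /frame_sum scaler_sumr; apply: eq_bigr => i _; rewrite ipZl scalerA.
Qed.

Lemma eq_frame_sum f f' g n x x' :
  (forall i, (i < n)%N -> ip x (f i) = ip x' (f' i)) ->
  frame_sum f g n x = frame_sum f' g n x'.
Proof. by move=> e; apply: eq_bigr => i _; rewrite e. Qed.

(** The norm of the left-hand side does not depend on g, so this is Bessel's
inequality. *)
Lemma frame_sum_le f g n x : orthofamily 1 n f -> orthofamily 1 n g ->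
  `|frame_sum f g n x| <= `|x|.
Proof.
move=> of_ og; rewrite -(@ler_pXn2r _ 2) ?nnegrE // -[leLHS]normE.
rewrite frame_sum_adj (frame_sumM _ _ _ og) scale1r -frame_sum_adj.
by rewrite ip_frame_suml Bessel.
Qed.

Lemma normalize_orthofamily l n w : 0 < l -> orthofamily l n w ->
  orthofamily 1 n (fun i => `|w i|^-1 *: w i).
Proof.
move=> l0 ow i j im jm; rewrite ipZl ipZr_ge0 ?invr_ge0 // mulr1 ow //.
have [->|] := eqVneq i j; last by rewrite mul0r !mulr0.
have wl : `|w j| ^+ 2 = l by rewrite -normE ow // eqxx mul1r.
have w0 : `|w j| != 0 by rewrite -sqrf_eq0 wl gt_eqF.
by rewrite mul1r -wl expr2 mulKf // mulVf.
Qed.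

(** * Infinite sums along orthonormal sequences *)

Definition orthonormal_seq (b : nat -> H) := forall n, orthofamily 1 n b.

Lemma orthonormal_seqE b i j : orthonormal_seq b -> ip (b i) (b j) = (i == j)%:R.
Proof.
move=> /(_ (maxn i j).+1 i j); rewrite !ltnS leq_maxl leq_maxr => -> //.
by rewrite mulr1.
Qed.

(** The squared distance of two partial sums is the difference of the
corresponding partial sums of the Bessel series of x, whatever g is. *)
Lemma frame_sum_cvg f g x : orthonormal_seq f -> orthonormal_seq g ->
  cvgn (fun n => frame_sum f g n x).
Proof.
move=> of_ og; apply: cauchy_seq_cvg => e e0.
pose s n := \sum_(i < n) ip x (f i) * ip (f i) x.
have sS n : s n <= s n.+1.
  rewrite /s big_ord_recr lerDl /=.
  have <- : ip (ip x (f n) *: f n) (ip x (f n) *: f n) = ip x (f n) * ip (f n) x.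
    by rewrite ipZl ipZr -ipC orthonormal_seqE // eqxx mulr1.
  by rewrite normE exprn_ge0.
have s0 n : 0 <= s n.
  by elim: n => [|n IH]; [rewrite /s big_ord0|exact: le_trans (sS n)].
have [N sN] := bounded_nondecreasing_cauchy scalars sS
  (fun n => Bessel x (of_ n)) (exprn_gt0 2 e0).
exists N => n Nn; rewrite distrC -(@ltr_pXn2r _ 2) ?nnegrE ?(ltW e0) //.
apply: le_lt_trans (sN n Nn).
(* s is real, hence the inner products below are too and commute. *)
have z_z p q : (p <= q)%N -> ip (frame_sum f g q x) (frame_sum f g p x) = s p.
  move=> pq; rewrite ip_frame_sumr; apply: eq_bigr => i _.
  by rewrite (frame_sum_coef _ _ (og q)) ?mul1r // (leq_trans (ltn_ord i)).
rewrite -normE ipBl !ipBr [ip (frame_sum f g N x) (frame_sum f g n x)]ipC.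
by rewrite !(z_z _ _ (leqnn _)) !(z_z _ _ Nn) (conj_ge0 scalars) // subrr subr0.
Qed.

Definition frame_series f g x : H := limn (fun n => frame_sum f g n x).

Lemma frame_series_adj f g x y : orthonormal_seq f -> orthonormal_seq g ->
  ip (frame_series f g x) y = ip x (frame_series g f y).
Proof.
move=> of_ og.
have cl := ip_cvgl (y := y) (frame_sum_cvg (x := x) of_ og).
have cr := ip_cvgr (y := x) (frame_sum_cvg (x := y) og of_).
apply: (cvg_unique (@norm_hausdorff K K) cl).
apply: cvg_trans cr; apply: near_eq_cvg; apply: nearW => n /=.
by rewrite frame_sum_adj.
Qed.

Lemma frame_series_basis f g j : orthonormal_seq f ->
  frame_series f g (f j) = g j.
Proof.
move=> of_; apply: cvg_lim => //; apply: cvg_near_cst.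
exists j.+1 => // n /= jn.
by rewrite (frame_sum_basis _ (of_ n)) ?scale1r.
Qed.

Lemma frame_series_orth f g x : (forall i, ip x (f i) = 0) ->
  frame_series f g x = 0.
Proof.
move=> xf; apply: cvg_lim => //; apply: cvg_near_cst.
by apply: nearW => n; rewrite frame_sum_orth.
Qed.

Lemma frame_series_coef f g x j : orthonormal_seq f -> orthonormal_seq g ->
  ip (frame_series f g x) (g j) = ip x (f j).
Proof. by move=> of_ og; rewrite frame_series_adj // frame_series_basis. Qed.

Lemma eq_frame_series f f' g x x' : (forall i, ip x (f i) = ip x' (f' i)) ->
  frame_series f g x = frame_series f' g x'.
Proof.
move=> e; rewrite /frame_series (_ : (fun _ => _) = (fun n => frame_sum f' g n x')) //.
by apply/funext => n; apply: eq_bigr => i _; rewrite e.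
Qed.

(** * An isometry whose adjoint has a nontrivial kernel *)

(** With f i = b (m + i), let S be the identity on the orthogonal complement of
the f i and f i |-> f (m + i) on their closed span. *)
Lemma shift_isometry b m : orthonormal_seq b ->
  exists S S' : H -> H,
  [/\ forall x y, ip (S x) y = ip x (S' y),
      forall x y, ip (S x) (S y) = ip x y,
      forall i, (i < m)%N -> S (b i) = b i &
      forall i, (i < m)%N -> S' (b (m + i)%N) = 0].
Proof.
move=> ob; pose f i := b (m + i)%N; pose g i := f (m + i)%N.
have of_ : orthonormal_seq f.
  by move=> n i j _ _; rewrite /f (orthonormal_seqE _ _ ob) eqn_add2l mulr1.
have og : orthonormal_seq g.
  by move=> n i j _ _; rewrite /g /f (orthonormal_seqE _ _ ob) !eqn_add2l mulr1.
(* P projects onto the span of the f i, A is the shift, A' its adjoint. *)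
pose P := frame_series f f; pose A := frame_series f g.
pose A' := frame_series g f.
have Padj x y : ip (P x) y = ip x (P y) by exact: frame_series_adj.
have Aadj x y : ip (A x) y = ip x (A' y) by exact: frame_series_adj.
have PP x : P (P x) = P x by apply: eq_frame_series => i; exact: frame_series_coef.
have A'A x : A' (A x) = P x.
  by apply: eq_frame_series => i; exact: frame_series_coef.
have A'P x : A' (P x) = A' x.
  by apply: eq_frame_series => i; exact: frame_series_coef.
have PA x : P (A x) = A x.
  by apply: ip_inj => y; rewrite Padj !Aadj A'P.
exists (fun x => x - P x + A x), (fun x => x - P x + A' x); split.
- by move=> x y; rewrite ipDl ipBl ipDr ipBr Padj Aadj.
- move=> x y /=; rewrite !(ipNl, ipNr, ipDl, ipDr) !Padj !Aadj A'P A'A PA PP; ring.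
- have bf i j : (i < m)%N -> ip (b i) (b (m + j)%N) = 0.
    move=> im; rewrite (orthonormal_seqE _ _ ob).
    by rewrite ltn_eqF // (leq_trans im) // leq_addr.
  move=> i im; rewrite /P /A !frame_series_orth ?subr0 ?addr0 // => j.
    exact: bf.
  exact: bf.
- move=> i im; rewrite -[b (m + i)%N]/(f i) /P frame_series_basis // subrr add0r.
  apply: frame_series_orth => j; rewrite /g (orthonormal_seqE _ _ of_).
  by rewrite ltn_eqF // (leq_trans im) // leq_addr.
Qed.

Lemma adj_sym S S' : (forall x y, ip (S x) y = ip x (S' y)) ->
  forall x y, ip (S' x) y = ip x (S y).
Proof. by move=> SS x y; rewrite ipC -SS -ipC. Qed.

(** A formal adjoint forces linearity: x |-> <x, S' z> is linear for every z. *)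
Lemma adj_linear S S' : (forall x y, ip (S x) y = ip x (S' y)) ->
  forall a x y, S (a *: x + y) = a *: S x + S y.
Proof.
by move=> SS a x y; apply: ip_inj => z; rewrite ipDl ipZl !SS ipDl ipZl.
Qed.

Lemma adj_add S S' : (forall x y, ip (S x) y = ip x (S' y)) ->
  forall x y, S (x + y) = S x + S y.
Proof. by move=> SS x y; apply: ip_inj => z; rewrite ipDl !SS ipDl. Qed.

Lemma adj_sub S S' : (forall x y, ip (S x) y = ip x (S' y)) ->
  forall x y, S (x - y) = S x - S y.
Proof. by move=> SS x y; apply: ip_inj => z; rewrite ipBl !SS ipBl. Qed.

Lemma adj_scale S S' : (forall x y, ip (S x) y = ip x (S' y)) ->
  forall a x, S (a *: x) = a *: S x.
Proof. by move=> SS a x; apply: ip_inj => z; rewrite ipZl !SS ipZl. Qed.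

(** The Neumann series of (1 - a S) ^ -1 applied to g: its partial sums p n are
dominated by those of a geometric series. *)
Lemma resolvent S S' (a : K) g : (forall x y, ip (S x) y = ip x (S' y)) ->
  (forall x y, ip (S x) (S y) = ip x y) -> 0 <= a -> a < 1 ->
  exists v, v = g + a *: S v.
Proof.
move=> adj iso a0 a1.
have SB x y : S x - S y = S (x - y).
  by apply: ip_inj => z; rewrite ipBl !adj ipBl.
have Sn x : `|S x| = `|x| by exact: isometry_norm.
pose p n := iter n (fun z => g + a *: S z) 0.
have pS n : p n.+1 = g + a *: S (p n) by [].
have dp n : `|p n.+1 - p n| <= a ^+ n * `|g|.
  elim: n => [|n IH].
    have S0 : S 0 = 0 by rewrite -[X in S X](subrr 0) -SB subrr.
    by rewrite expr0 mul1r pS [p 0%N]/(0) S0 scaler0 addr0 subr0.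
  rewrite [p n.+2]pS [X in _ - X]pS opprD addrACA subrr add0r -scalerBr SB.
  by rewrite normrZ Sn ger0_norm // exprS -mulrA ler_wpM2l.
pose s n := \sum_(i < n) a ^+ i * `|g|.
have sS n : s n <= s n.+1.
  by rewrite /s big_ord_recr lerDl mulr_ge0 ?exprn_ge0.
have s_le n : s n <= (1 - a)^-1 * `|g|.
  rewrite /s -mulr_suml ler_wpM2r // -[leRHS]mul1r ler_pdivlMr ?subr_gt0 //.
  by rewrite mulrC -[1 - a]opprB mulNr -subrX1 opprB gerBl exprn_ge0.
have sp N n : (N <= n)%N -> `|p n - p N| <= s n - s N.
  move=> Nn; rewrite -(subnK Nn); elim: (n - N)%N => [|k IH].
    by rewrite !subrr normr0.
  rewrite addSn; set q := (k + N)%N in IH *.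
  rewrite -(subrKA (p q)); apply: le_trans (ler_normD _ _) _.
  rewrite [s _]big_ord_recr /= -/(s q) [s q + _]addrC -[leRHS]addrA.
  by apply: lerD; [exact: dp|exact: IH].
have /cvg_ex[v /= pv] : cvgn p.
  apply: cauchy_seq_cvg => e e0.
  have [N sN] := bounded_nondecreasing_cauchy scalars sS s_le e0.
  exists N => n Nn; rewrite distrC.
  exact: le_lt_trans (sp _ _ Nn) (sN _ Nn).
exists v; apply: (cvg_unique (@norm_hausdorff K H) pv).
rewrite /= -(cvg_shiftS p); apply/cvgrPdist_lt => e e0.
move/cvgrPdist_lt : pv => /(_ e e0); apply: filterS => n.
apply: le_lt_trans; rewrite [X in _ - X](pS n) opprD addrACA subrr add0r.
by rewrite -scalerBr SB normrZ Sn ger0_norm // ler_piMl // ltW.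
Qed.

(** * Near-doubling 2-isometries *)

(** Linearity is left out because the adjoint T' implies it. *)
Definition two_isometric_pair (T T' : H -> H) := [/\
  forall x y, ip (T x) y = ip x (T' y),
  exists M : K, forall x, `|T x| <= M * `|x| &
  forall x, x - 2 *: T' (T x) + T' (T' (T (T x))) = 0].

(** On the span of the u i the adjoint of S is multiplication by a, and the
factor 1 + (1/a - 1) = 1/a undoes it: T' fixes the u i. Hence T' Q = Q = Q T for
the projection Q onto that span, and the 2-isometry identity follows from
T' T = 1 + (1/a^2 - 1) Q. *)
Lemma rank_perturbed_isometry S S' m u a :
  (forall x y, ip (S x) y = ip x (S' y)) ->
  (forall x y, ip (S x) (S y) = ip x y) ->
  0 < a -> orthofamily 1 m u -> (forall i, (i < m)%N -> S' (u i) = a *: u i) ->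
  exists T T' : H -> H, two_isometric_pair T T' /\
    forall x, T x = S (x + (a^-1 - 1) *: frame_sum u u m x).
Proof.
move=> adj iso a0 ou eig; set c := a^-1 - 1; pose Q := frame_sum u u m.
have a_neq0 : a != 0 by rewrite gt_eqF.
have adj' := adj_sym adj.
have S'S x : S' (S x) = x by apply: ip_inj => y; rewrite adj' iso.
have Qadj x y : ip (Q x) y = ip x (Q y) by exact: frame_sum_adj.
have Qlin := adj_linear Qadj.
have QQ x : Q (Q x) = Q x by rewrite /Q (frame_sumM _ _ _ ou) scale1r.
have c_ge y z : ip y (c *: z) = c * ip y z.
  by rewrite /c scalerBl ipBr ipZr_ge0 ?invr_ge0 ?ltW // ipZr_ge0 // mulrBl.
pose T x := S (x + c *: Q x); pose T' y := S' y + c *: Q (S' y).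
have Tadj x y : ip (T x) y = ip x (T' y).
  by rewrite adj ipDl ipDr ipZl c_ge Qadj.
have T'lin := adj_linear (adj_sym Tadj).
have T'u i : (i < m)%N -> T' (u i) = u i.
  move=> im; rewrite /T' eig // -[a *: u i]addr0 Qlin.
  have -> : Q 0 = 0 by apply: frame_sum_orth => j _; rewrite ip0l.
  rewrite !addr0 /Q (frame_sum_basis _ ou) // scale1r scalerA -scalerDl.
  by rewrite (_ : a + c * a = 1) ?scale1r // /c; field.
have QT x : Q (T x) = Q x.
  by apply: eq_bigr => i _; rewrite Tadj T'u.
have T'Q x : T' (Q x) = Q x.
  by apply: ip_inj => y; rewrite ipC -Tadj -ipC Qadj QT -Qadj.
have T'T x : T' (T x) = x + (c * (c + 2)) *: Q x.
  rewrite /T' /T !S'S; have -> : Q (x + c *: Q x) = (1 + c) *: Q x.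
    by rewrite addrC Qlin QQ scalerDl scale1r addrC.
  rewrite scalerA -addrA -scalerDl; congr (_ + _ *: _); ring.
exists T, T'; split=> //; split=> // [|x].
  exists (1 + `|c|) => x; rewrite (isometry_norm (iso _ _)).
  apply: le_trans (ler_normD _ _) _; rewrite mulrDl mul1r lerD2l normrZ.
  by rewrite ler_wpM2l // frame_sum_le.
set d := c * (c + 2) in T'T.
rewrite [T' (T (T x))]T'T QT [T x + _]addrC T'lin T'Q T'T.
rewrite scaler_nat mulr2n; set A := x + d *: Q x.
rewrite opprD [d *: _ + A]addrC [x + _]addrA [_ + (A + _)]addrA subrK.
by rewrite opprD addrA subrr add0r addNr.
Qed.

(** With 2 y = S y + S u and d = a / (2 - a), the vectors are x = y + d u. The
equation for y gives <y i, u j> = d when i = j and 0 otherwise, so x has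
component 2 d along u, and d + (1/a - 1) 2 d = 1 is the coefficient of S u in
the image of x; that image is therefore S y + S u = 2 y. The same equation and
the isometry of S determine all <y i, y j>. A fixed vector z of S is orthogonal
to u, since <u, z> = <u, S z> = a <u, z>, and then to y. *)
Lemma near_eigenvectors S S' m u a :
  (forall x y, ip (S x) y = ip x (S' y)) ->
  (forall x y, ip (S x) (S y) = ip x y) ->
  0 < a -> a < 1 -> orthofamily 1 m u ->
  (forall i, (i < m)%N -> S' (u i) = a *: u i) ->
  exists x : nat -> H, [/\
    forall i, (i < m)%N ->
      S (x i + (a^-1 - 1) *: frame_sum u u m (x i)) - 2 *: x i =
      - (2 * (a / (2 - a))) *: u i,
    exists2 l : K, 1 / 4 <= l & orthofamily l m x &
    forall z, S z = z -> forall i, (i < m)%N -> ip (x i) z = 0].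
Proof.
move=> adj iso a0 a1 ou eig; pose d := a / (2 - a).
have adj' := adj_sym adj.
have Slin := adj_linear adj.
have h0 : 0 <= 2^-1 :> K by rewrite invr_ge0.
have h1 : 2^-1 < 1 :> K by rewrite invf_lt1 // ltr1n.
(* y i is the image of S (u i) / 2 under the resolvent of S at 1/2. *)
have /choice[y yE] i : exists y, y = 2^-1 *: S (u i) + 2^-1 *: S y.
  exact: resolvent adj iso h0 h1.
have a2 : 2 - a != 0 by rewrite gt_eqF // subr_gt0 (lt_trans a1) // ltr1n.
have SyE i : S (y i) = 2 *: y i - S (u i).
  by rewrite {2}yE -scalerDr scalerA mulfV ?pnatr_eq0 // scale1r addrAC subrr add0r.
have yu i j : (i < m)%N -> (j < m)%N -> ip (y i) (u j) = (i == j)%:R * d.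
  move=> im jm; apply: (mulfI a2); rewrite mulrBl.
  have e : 2 * ip (y i) (u j) = a * ((i == j)%:R + ip (y i) (u j)).
    rewrite {1}yE ipDl !ipZl !adj eig // !(ipZr_ge0 _ _ (ltW a0)) ou //.
    by field.
  by rewrite e /d; field.
have d0 : 0 <= d by rewrite divr_ge0 ?ltW // subr_gt0 (lt_trans a1) // ltr1n.
have uy i j : (i < m)%N -> (j < m)%N -> ip (u i) (y j) = (i == j)%:R * d.
  by move=> im jm; rewrite ipC yu // eq_sym (conj_ge0 scalars) // mulr_ge0 ?ler0n.
have yy i j : (i < m)%N -> (j < m)%N ->
    ip (y i) (y j) = (i == j)%:R * ((1 + 2 * d) / 3).
  move=> im jm.
  have yE' k : y k = 2^-1 *: (S (u k) + S (y k)) by rewrite {1}yE scalerDr.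
  have : 4 * ip (y i) (y j) = ip (y i) (y j) + (i == j)%:R * (1 + 2 * d).
    rewrite {1}(yE' i) {1}(yE' j) ipZl (ipZr_ge0 _ _ h0) !(ipDl, ipDr) !iso.
    by rewrite ou // yu // uy //; field.
  move=> e; apply: (mulfI (_ : 3 != 0 :> K)); first by rewrite pnatr_eq0.
  by rewrite (_ : 3 = 4 - 1 :> K) ?mulrBl ?e; [field|ring].
exists (fun i => y i + d *: u i); split.
- move=> i im.
  have QE : frame_sum u u m (y i + d *: u i) = (2 * d) *: u i.
    rewrite -[u i in RHS]scale1r -(frame_sum_basis u ou im) -frame_sumZ.
    apply: eq_frame_sum => k km; rewrite ipDl !ipZl yu // ou //; ring.
  rewrite QE [y i + _]addrC -addrA [y i + _]addrC addrA scalerA -scalerDl.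
  rewrite (_ : d + (a^-1 - 1) * (2 * d) = 1); last first.
    by rewrite /d; field; rewrite a2 gt_eqF.
  rewrite Slin SyE scale1r [S (u i) + _]addrC subrK scalerDr opprD.
  by rewrite [_ + - (2 *: y i)]addrC addrA subrr add0r scalerA scaleNr.
(* <y,y> = (1 + 2 d) / 3, and the terms with u add 2 d^2 + d^2. *)
- exists ((1 + 2 * d) / 3 + 3 * d ^+ 2).
    have d2 : 0 <= 3 * d ^+ 2 by rewrite mulr_ge0 ?exprn_ge0.
    have d3 : 0 <= 2 * d by rewrite mulr_ge0.
    rewrite -[leLHS]addr0 lerD // ler_pM ?invr_ge0 ?lerDl //.
    by rewrite lef_pV2 ?posrE ?ltr0n // ler_nat.
  move=> i j im jm; rewrite !(ipDl, ipDr) !ipZl !(ipZr_ge0 _ _ d0).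
  by rewrite yy // yu // uy // ou //; field.
- move=> z Sz i im.
  have uz : ip (u i) z = 0.
    have : ip (u i) z = a * ip (u i) z.
      by rewrite -{1}Sz -adj' eig // ipZl.
    move/eqP; rewrite -subr_eq0 -{1}[ip _ _]mul1r -mulrBl mulf_eq0.
    by rewrite subr_eq0 gt_eqF //= => /eqP.
  have yz : ip (y i) z = 0.
    have : 2 * ip (y i) z = ip (y i) z.
      rewrite {1}yE -{1}Sz -scalerDr ipZl mulVKf ?pnatr_eq0 // ipDl !iso uz.
      by rewrite add0r.
    move/eqP; rewrite -subr_eq0 mulr_natl mulr2n addrK => /eqP; exact.
  by rewrite ipDl ipZl yz uz mulr0 addr0.
Qed.

(** The vectors v i = b (m + i) + a S (v i) are eigenvectors of S' for a, because
S' kills b (m + i) for i < m; they are orthogonal and of equal norm. *)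
Lemma two_isometry_near_double b m a : orthonormal_seq b -> 0 < a -> a < 1 ->
  exists T T' : H -> H, two_isometric_pair T T' /\
    exists e : nat -> H, [/\ orthofamily 1 m e,
      forall i j, (i < m)%N -> (j < m)%N -> ip (e i) (b j) = 0 &
      forall i, (i < m)%N -> `|T (e i) - 2 *: e i| <= 4 * a].
Proof.
move=> ob a0 a1.
have [S [S' [adj iso Sb S'f]]] := shift_isometry m ob.
have adj' := adj_sym adj.
have S'S x : S' (S x) = x by apply: ip_inj => y; rewrite adj' iso.
have S'lin := adj_linear adj'.
have /choice[v vE] i : exists v, v = b (m + i)%N + a *: S v.
  exact: resolvent adj iso (ltW a0) a1.
have S'v i : (i < m)%N -> S' (v i) = a *: v i.
  by move=> im; rewrite {1}vE addrC S'lin S'f // S'S addr0.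
have a2 : 0 < 1 - a ^+ 2 by rewrite subr_gt0 expr_lt1 // ltW.
have ov : orthofamily (1 - a ^+ 2)^-1 m v.
  move=> i j im jm; apply: (mulfI (lt0r_neq0 a2)).
  rewrite [RHS]mulrCA (divff (lt0r_neq0 a2)) mulr1 mulrBl mul1r {1}(vE i) {1}(vE j).
  rewrite !(ipDl, ipDr) !ipZl !(ipZr_ge0 _ _ (ltW a0)) iso.
  rewrite adj S'f // ip0r -adj' S'f // ip0l (orthonormal_seqE _ _ ob) eqn_add2l.
  ring.
pose u i := `|v i|^-1 *: v i.
have ou : orthofamily 1 m u.
  by apply: normalize_orthofamily ov; rewrite invr_gt0.
have S'u i : (i < m)%N -> S' (u i) = a *: u i.
  by move=> im; rewrite (adj_scale adj') S'v // !scalerA mulrC.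
have [T [T' [TT' TE]]] := rank_perturbed_isometry adj iso a0 ou S'u.
have [x [Tx [l l4 ox] xfix]] := near_eigenvectors adj iso a0 a1 ou S'u.
have l0 : 0 < l by apply: lt_le_trans l4; rewrite divr_gt0.
exists T, T'; split=> //; exists (fun i => `|x i|^-1 *: x i); split.
- exact: normalize_orthofamily ox.
- by move=> i j im jm; rewrite ipZl xfix ?mulr0 // Sb.
move=> i im.
have [Tadj _ _] := TT'; rewrite (adj_scale Tadj) scalerA [2 * _]mulrC -scalerA.
rewrite -scalerBr TE Tx //.
rewrite normrZ normfV normr_id [`|- _ *: _|]normrZ normrN.
(* The error is 2 (a / (2 - a)) / |x i|, where a / (2 - a) <= a and
   1/2 <= |x i|. *)
have u1 : `|u i| = 1.
  by apply/eqP; rewrite -(@eqrXn2 _ 2) // -normE ou // eqxx mul1r expr1n.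
have x_ge : 1 / 2 <= `|x i|.
  have xl : `|x i| ^+ 2 = l by rewrite -normE ox // eqxx mul1r.
  rewrite -(@ler_pXn2r _ 2) ?nnegrE ?divr_ge0 // xl.
  by apply: le_trans l4; rewrite expr_div_n expr1n -natrX.
have a2_ge1 : 1 <= 2 - a.
  by rewrite (_ : 2 = 1 + 1) // -addrA lerDl subr_ge0 ltW.
have da : a / (2 - a) <= a.
  by rewrite ler_pdivrMr ?(lt_le_trans ltr01) // ler_peMr // ltW.
have d0 : 0 <= 2 * (a / (2 - a)).
  by rewrite mulr_ge0 // divr_ge0 ?ltW // (lt_le_trans ltr01).
rewrite u1 mulr1 (ger0_norm d0) mulrC ler_pdivrMr; last first.
  by apply: lt_le_trans x_ge; rewrite divr_gt0.
rewrite (le_trans (ler_wpM2l _ da)) // (_ : 2 * a = 4 * a * (1 / 2)); last by field.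
by rewrite ler_wpM2l // mulr_ge0 // ltW.
Qed.

(** * Moving the doubled vectors *)

(** For orthogonal vectors w i of squared length 2 this is the product of the
reflections in the hyperplanes orthogonal to the w i. *)
Definition reflection w m x := x - frame_sum w w m x.

Lemma reflection_adj w m x y :
  ip (reflection w m x) y = ip x (reflection w m y).
Proof. by rewrite ipBl ipBr frame_sum_adj. Qed.

Lemma reflectionK w m : orthofamily 2 m w -> involutive (reflection w m).
Proof.
move=> ow x; apply: ip_inj => y; rewrite reflection_adj ipBl !ipBr.
by rewrite !frame_sum_adj (frame_sumM _ _ _ ow) ipZr_ge0 //; ring.
Qed.

Lemma reflection_norm w m x : orthofamily 2 m w -> `|reflection w m x| = `|x|.
Proof.
by move=> ow; apply: isometry_norm; rewrite reflection_adj reflectionK.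
Qed.

Lemma two_isometric_conj T T' m w : two_isometric_pair T T' ->
  orthofamily 2 m w -> let U := reflection w m in
  two_isometric_pair (fun x => U (T (U x))) (fun x => U (T' (U x))).
Proof.
move=> [Tadj [M TM] Tid] ow U.
have Uadj x y : ip (U x) y = ip x (U y) by exact: reflection_adj.
have UU : involutive U by exact: reflectionK.
have Un x : `|U x| = `|x| by exact: reflection_norm.
split=> [x y||x].
- by rewrite Uadj Tadj Uadj.
- by exists M => x; rewrite Un -(Un x).
- rewrite !UU.
  have U0 : U 0 = 0 by rewrite -(scale0r 0) (adj_scale Uadj) !scale0r.
  have := congr1 U (Tid (U x)); rewrite U0 => <-.
  by rewrite (adj_add Uadj) (adj_sub Uadj) (adj_scale Uadj) UU.
Qed.

(** The reflections along the w i = b i - e i exchange b i and e i; conjugation by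
their product, which is unitary, moves the estimate from the e i to the b i. *)
Lemma two_isometry_near_double_on b m a : orthonormal_seq b -> 0 < a -> a < 1 ->
  exists T T' : H -> H, two_isometric_pair T T' /\
    forall i, (i < m)%N -> `|T (b i) - 2 *: b i| <= 4 * a.
Proof.
move=> ob a0 a1.
have [T [T' [TT' [e [oe eb Te]]]]] := two_isometry_near_double m ob a0 a1.
have be i j : (i < m)%N -> (j < m)%N -> ip (b j) (e i) = 0.
  by move=> im jm; apply: ip_eq0C; exact: eb.
pose w i := b i - e i.
have ow : orthofamily 2 m w.
  move=> i j im jm; rewrite ipBl !ipBr eb // be // oe // (orthonormal_seqE _ _ ob).
  ring.
pose U := reflection w m.
have Ue i : (i < m)%N -> U (e i) = b i.
  move=> im; rewrite /U /reflection.
  (* e i and - w i / 2 differ by (e i + b i) / 2, which is orthogonal to all w j. *)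
  rewrite (@eq_frame_sum _ w _ _ _ ((- 2^-1) *: w i)); last first.
    by move=> j jm; rewrite ipBr ipZl ow // eb // oe //; field.
  rewrite frame_sumZ (frame_sum_basis _ ow) // scalerA mulNr mulVf ?pnatr_eq0 //.
  by rewrite scaleN1r opprK addrCA subrr addr0.
exists (fun x => U (T (U x))), (fun x => U (T' (U x))).
split; first exact: two_isometric_conj.
have Uadj x y : ip (U x) y = ip x (U y) by exact: reflection_adj.
move=> i im; rewrite -(Ue i im) [U (U _)]reflectionK // -(adj_scale Uadj).
by rewrite -(adj_sub Uadj) reflection_norm // Te.
Qed.

(** The adjoint inherits the bound M: |T' x|^2 = <T (T' x), x> is at most
M |T' x| |x|. *)
Lemma two_isometry_of_pair T T' : two_isometric_pair T T' ->
  exists2 B : bounded_operator H, two_isometry ip B & forall x, B x = T x.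
Proof.
move=> [adj [M TM] Tid].
have adj' := adj_sym adj.
have T'M x : `|T' x| <= M * `|x|.
  have [->|n0] := eqVneq (T' x) 0.
    by rewrite normr0; apply: le_trans (TM x).
  rewrite -(@ler_pM2r _ `|T' x|) ?normr_gt0 // -expr2 -normE -adj.
  have := CauchySchwarz (T (T' x)) x; rewrite adj normE normrX normr_id.
  by move=> /le_trans-> //; rewrite -mulrA [`|x| * _]mulrC mulrA ler_wpM2r.
pose LT := GRing.isLinear.Build K H H *:%R T (adj_linear adj).
pose LT' := GRing.isLinear.Build K H H *:%R T' (adj_linear adj').
pose linT : {linear H -> H} := HB.pack T LT.
pose linT' : {linear H -> H} := HB.pack T' LT'.
pose B := @BoundedOperator K H linT (ex_intro _ M TM).
pose B' := @BoundedOperator K H linT' (ex_intro _ M T'M).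
by exists B => //; exists B'.
Qed.

(** * Orthonormal sequences *)

(** The Gram-Schmidt step. When x already lies in the span of the b i, the
normalized residual of a vector outside that span is used instead of that of
x. *)
Lemma next_orthonormal b n x : infinite_dimensional H -> orthofamily 1 n b ->
  exists w, [/\ ip w w = 1, forall i, (i < n)%N -> ip w (b i) = 0 &
    x = frame_sum b b n x + ip x w *: w].
Proof.
move=> Hinf ob.
have residual z i : (i < n)%N -> ip (z - frame_sum b b n z) (b i) = 0.
  by move=> im; rewrite ipBl (frame_sum_coef _ _ ob) // mul1r subrr.
have unit z : z != 0 -> ip (`|z|^-1 *: z) (`|z|^-1 *: z) = 1.
  move=> z0; rewrite normE normrZ normfV normr_id mulVf ?expr1n //.
  by rewrite normr_eq0.
have [x0|x0] := eqVneq (x - frame_sum b b n x) 0; last first.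
  exists (`|x - frame_sum b b n x|^-1 *: (x - frame_sum b b n x)); split.
  - exact: unit.
  - by move=> i im; rewrite ipZl residual ?mulr0.
  - set r := x - _; rewrite ipZr_ge0 ?invr_ge0 // scalerA.
    have -> : ip x r = `|r| ^+ 2.
      rewrite -normE {3}/r ipBl ip_frame_suml big1 ?subr0 // => i _.
      by rewrite (ip_eq0C (residual x i _)) ?mulr0.
    rewrite expr2 mulKf ?normr_eq0 // mulfV ?normr_eq0 // scale1r.
    by rewrite addrC subrK.
have [y y0] : exists y, y - frame_sum b b n y != 0.
  apply: contrapT => /forallNP fin; apply: Hinf.
  exists n, (fun i => b i) => z; exists (fun i => ip z (b i)).
  by have /negP/negPn := fin z; rewrite subr_eq0 => /eqP.
exists (`|y - frame_sum b b n y|^-1 *: (y - frame_sum b b n y)); split.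
- exact: unit.
- by move=> i im; rewrite ipZl residual ?mulr0.
- move/eqP : x0; rewrite subr_eq0 => /eqP x0.
  rewrite {3}x0 ipZr_ge0 ?invr_ge0 // ip_frame_suml big1 ?mulr0 ?scale0r ?addr0 //.
  by move=> i _; rewrite (ip_eq0C (residual y i _)) ?mulr0.
Qed.

(** Each step may fall back on a fresh vector, so x need not be free, and b is
infinite even if x spans a finite-dimensional space. *)
Lemma Gram_Schmidt (x : nat -> H) : infinite_dimensional H ->
  exists2 b, orthonormal_seq b &
    forall m i, (i < m)%N -> x i = frame_sum b b m (x i).
Proof.
move=> Hinf.
have /choice[pick pickP] (nb : nat * (nat -> H)) : exists w,
    orthofamily 1 nb.1 nb.2 -> [/\ ip w w = 1,
      forall i, (i < nb.1)%N -> ip w (nb.2 i) = 0 &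
      x nb.1 = frame_sum nb.2 nb.2 nb.1 (x nb.1) + ip (x nb.1) w *: w].
  have [ob|nob] := pselect (orthofamily 1 nb.1 nb.2); last by exists 0.
  by have [w wP] := next_orthonormal (x nb.1) Hinf ob; exists w.
(* F n lists the first n vectors of b, which pick needs to form b n. *)
pose F := fix F n : seq H := if n is n'.+1 then
  rcons (F n') (pick (n', nth 0 (F n'))) else [::].
pose b n := pick (n, nth 0 (F n)).
have sF n : size (F n) = n by elim: n => //= n; rewrite size_rcons => ->.
have Fb n i : (i < n)%N -> nth 0 (F n) i = b i.
  elim: n => // n IH; rewrite ltnS leq_eqVlt /= nth_rcons sF => /predU1P[->|ilt].
    by rewrite ltnn eqxx.
  by rewrite ilt IH.
have obF n : orthofamily 1 n b -> orthofamily 1 n (nth 0 (F n)).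
  by move=> ob i j im jm; rewrite !Fb // ob.
have ob : orthonormal_seq b.
  elim=> // n IH; have [bb bn _] := pickP (n, nth 0 (F n)) (obF _ IH).
  have bn' i : (i < n)%N -> ip (b n) (b i) = 0 by move=> im; rewrite -(Fb n i im) bn.
  move=> i j; rewrite ltnS leq_eqVlt => /predU1P[->|im];
    rewrite ltnS leq_eqVlt => /predU1P[->|jm].
  - by rewrite eqxx mul1r.
  - by rewrite bn' // gtn_eqF // mul0r.
  - by rewrite ip_eq0C ?bn' // ltn_eqF // mul0r.
  - exact: IH.
exists b => // m i im.
have [_ _ xE] := pickP (i, nth 0 (F i)) (obF _ (ob i)).
have xE' : x i = frame_sum b b i.+1 (x i).
  rewrite {1}xE /frame_sum big_ord_recr /=; congr (_ + _).
  by apply: eq_bigr => j _; rewrite Fb.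
elim: m im => // m IH; rewrite ltnS leq_eqVlt => /predU1P[<- //|im].
rewrite /frame_sum big_ord_recr -/(frame_sum b b m (x i)) -IH //=.
rewrite [ip (x i) _](_ : _ = 0) ?scale0r ?addr0 //.
rewrite xE' ip_frame_suml big1 // => j _; rewrite (orthonormal_seqE _ _ ob).
by rewrite ltn_eqF ?mulr0 // (leq_trans (ltn_ord j)).
Qed.

(** * Strong closure *)

Lemma two_isometry_near_double_on_list (s : seq H) (e : K) :
  infinite_dimensional H -> 0 < e ->
  exists2 B : bounded_operator H, two_isometry ip B &
    forall x, x \in s -> `|B x - 2 *: x| < e.
Proof.
move=> Hinf e0; pose m := size s.
have [b ob bs] := Gram_Schmidt (nth 0 s) Hinf.
pose M := \sum_(x <- s) `|x|.
have M0 : 0 <= M by exact: sumr_ge0.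
(* Each of the m coefficients of a listed x is at most M, each error at most
   4 a; a = e / D makes the total less than e, and is itself less than 1. *)
pose D := 4 * m%:R * M + e + e.
have mM0 : 0 <= 4 * m%:R * M by rewrite mulr_ge0 ?mulr_ge0 ?ler0n.
have D0 : 0 < D by rewrite addr_gt0 // ltr_wpDl.
pose a := e / D.
have a0 : 0 < a by rewrite divr_gt0.
have a1 : a < 1.
  by rewrite ltr_pdivrMr // mul1r ltrDr ltr_wpDl.
have [T [T' [TT' Tb]]] := two_isometry_near_double_on m ob a0 a1.
have [B B2 BT] := two_isometry_of_pair TT'; exists B => // x xs.
have xE : x = frame_sum b b m x.
  by rewrite -(nth_index 0 xs); apply: bs; rewrite index_mem.
have -> : B x - 2 *: x = \sum_(i < m) ip x (b i) *: (T (b i) - 2 *: b i).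
  rewrite {1 2}xE /frame_sum linear_sum scaler_sumr -sumrB.
  apply: eq_bigr => i _.
  by rewrite linearZ /= BT scalerBr !scalerA [2 * _]mulrC.
apply: le_lt_trans (_ : 4 * m%:R * M * a < e); last first.
  by rewrite /a mulrA ltr_pdivrMr // mulrC ltr_pM2l // /D -addrA ltrDl addr_gt0.
apply: le_trans (ler_norm_sum _ _ _) _.
apply: le_trans (_ : \sum_(i < m) M * (4 * a) <= _).
  apply: ler_sum => i _; rewrite normrZ ler_pM // ?Tb //.
  have bi : `|b i| = 1.
    by apply/eqP; rewrite -(@eqrXn2 _ 2) // -normE (orthonormal_seqE _ _ ob) eqxx expr1n.
  apply: le_trans (CauchySchwarz _ _) _; rewrite bi mulr1 /M (big_rem x) //=.
  by rewrite lerDl sumr_ge0.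
rewrite sumr_const card_ord -[leLHS]mulr_natr.
by rewrite (_ : _ * m%:R = 4 * m%:R * M * a) //; ring.
Qed.

End InnerProduct.

Theorem theorem1 (R : realType) (K : numFieldType) (theta : K -> K)
    (scalars : real_or_complex R theta)
    (H : completeNormedModType K) (ip : {dot H for theta})
    (normE : forall x : H, ip x x = `|x| ^+ 2)
    (H_infinite : infinite_dimensional H) :
  closure [set T : sot H | two_isometry ip T] (scale_operator H 2 : sot H).
Proof.
(* F is the filter of the net, indexed by finite lists of vectors and positive
   tolerances, of 2-isometries that double the list up to the tolerance. *)
pose D : set (seq H * K) := [set se | 0 < se.2].
pose N (se : seq H * K) : set (sot H) := [set T | two_isometry ip T /\
  forall x, x \in se.1 -> `|(T : bounded_operator H) x - 2 *: x| < se.2].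
pose F := filter_from D N.
have FF : Filter F.
  apply: filter_from_filter => [|[s e] [s' e'] /= e0 e'0].
    by exists ([::], 1) => /=; rewrite /D /= ltr01.
  have ee' : e >=< e' by rewrite real_comparable ?gtr0_real.
  exists (s ++ s', Num.min e e'); first by rewrite /D /= comparable_lt_min // e0.
  move=> T [T2 Ts]; split; split=> // x xs; have := Ts x.
    by rewrite mem_cat xs comparable_lt_min // => /(_ isT) /andP[].
  by rewrite mem_cat xs orbT comparable_lt_min // => /(_ isT) /andP[].
have PF : ProperFilter F.
  apply: filter_from_proper => -[s e] /= e0.
  have [B B2 Bs] := two_isometry_near_double_on_list scalars normE s H_infinite e0.
  by exists B.
have Fcvg : F --> (scale_operator H 2 : sot H).
  apply/sot_cvgP => x; apply/cvgrPdist_lt => e e0.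
  exists ([:: x], e) => //= T [_ Tx] /=.
  by rewrite distrC; apply: Tx; rewrite mem_seq1.
move=> B /Fcvg FB; apply: (@filter_ex _ F); apply: filterI => //.
by exists ([::], 1) => [|T []//]; rewrite /D /= ltr01.
Qed.
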